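(* For all graphs $G$ and integers $k \geq 3$, we have $$f_k^{-1}(\omega(G)) \;\leq\; c_{\{\psi \leq k\}}(G) \;\leq\; \left\lceil \frac{\psi(G) - 1}{\left\lfloor \frac{k-1}{2} \right\rfloor} \right\rceil \cdot \left\lceil \frac{\psi(G) - 1}{\left\lceil \frac{k-1}{2} \right\rceil} \right\rceil ,$$ where $f_k$ is the function defined recursively by $f_k(1) = k$ and $f_k(c) = c\,(k-1)\, f_k(c-1)$ for $c \geq 2$; this $f_k(x)$ is a function of the order $O(x!\cdot k^x)$.
   Context: All graphs are finite, undirected and simple. $\omega(G)$ is the clique number of $G$ (the largest $n$ such that $G$ contains a complete subgraph on $n$ vertices). The local chromatic number $\psi(G)$ is the minimum, over all proper vertex colorings $\phi$ of $G$ (with any number of colors), of $\max_{v \in V(G)} |\{\phi(u) : u \in N[v]\}|$, where $N[v]$ is the closed neighborhood of $v$ ($v$ together with its neighbors). For an integer $k$, $\{\psi \leq k\}$ denotes the class of all graphs $H$ with $\psi(H) \leq k$. For a graph class $\mathcal P$ containing $K_2$, the cover number $c_{\mathcal P}(G)$ is the smallest number $c$ such that there are subgraphs $G_1,\dots,G_c$ of $G$, each belonging to $\mathcal P$, with $E(G) = E(G_1)\cup\dots\cup E(G_c)$ (the subgraphs need not be edge-disjoint). The function $f_k$ is defined on the positive integers, and $f_k^{-1}(n)$ means the least positive integer $c$ with $f_k(c) \geq n$.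
   Formalization: The lower bound is stated only for graphs with at least one edge, since for a nonempty edgeless graph ψ(G) = 1 makes the right-hand side 0 while f_k^{-1}(ω(G)) = 1, so the chain fails; the upper bound is kept for all graphs. *)

(* Defs.v *)
From mathcomp Require Import all_boot boolp.

Set Implicit Arguments.
Unset Strict Implicit.
Unset Printing Implicit Defensive.

(* The least natural number satisfying P; it is 0 when there is none. *)
Definition least_nat (P : nat -> Prop) : nat :=
  if pselect (exists n, `[< P n >]) is left exP then ex_minn exP else 0.

Lemma least_natP (P : nat -> Prop) (n : nat) :
  P n -> P (least_nat P) /\ least_nat P <= n.
Proof.
move=> Pn; rewrite /least_nat; case: pselect => [exP | []]; last first.
  by exists n; apply/asboolP.
case: ex_minnP => m /asboolP Pm min_m; split=> //.
by apply: min_m; apply/asboolP.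
Qed.

Definition ceil_divn (m d : nat) : nat := (m + d.-1) %/ d.

Record sgraph := SGraph {
  vertex :> finType;
  edge : rel vertex;
  edge_sym : symmetric edge;
  edge_irrefl : irreflexive edge
}.

(* An edgeless nonempty graph has cover number 0 but fk_inv k 1 = 1, so the
   lower bound on the cover number needs an edge. *)
Definition has_edge (G : sgraph) : Prop := exists x y : G, edge x y.

Definition is_clique (G : sgraph) (A : {set G}) : bool :=
  [forall x in A, forall y in A, (x != y) ==> edge x y].

Definition clique_number (G : sgraph) : nat :=
  \max_(A : {set G} | is_clique A) #|A|.

Definition closed_nbhd (G : sgraph) (v : G) : {set G} :=
  [set u | (u == v) || edge v u].

Definition proper_coloring (G : sgraph) (phi : G -> nat) : Prop :=
  forall x y : G, edge x y -> phi x <> phi y.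

Definition local_colors (G : sgraph) (phi : G -> nat) : nat :=
  \max_(v : G) size (undup [seq phi u | u in closed_nbhd v]).

Definition local_chromatic_number (G : sgraph) : nat :=
  least_nat (fun m =>
    exists phi : G -> nat, proper_coloring phi /\ local_colors phi = m).

Definition local_chromatic_le (k : nat) (G : sgraph) : Prop :=
  local_chromatic_number G <= k.

Record subgraph (G : sgraph) := Subgraph {
  sub_vertices : {set G};
  sub_edge : rel G;
  sub_edge_sym : symmetric sub_edge;
  sub_edgeP : forall x y, sub_edge x y ->
    [/\ x \in sub_vertices, y \in sub_vertices & edge x y]
}.

Definition subgraph_vertex (G : sgraph) (H : subgraph G) : finType :=
  {x : G | x \in sub_vertices H}.

Definition subgraph_edge (G : sgraph) (H : subgraph G) :
    rel (subgraph_vertex H) :=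
  fun x y => sub_edge H (val x) (val y).

Lemma subgraph_edge_sym (G : sgraph) (H : subgraph G) :
  symmetric (@subgraph_edge G H).
Proof. by move=> x y; apply: sub_edge_sym. Qed.

Lemma subgraph_edge_irrefl (G : sgraph) (H : subgraph G) :
  irreflexive (@subgraph_edge G H).
Proof. by move=> x; apply/negP => /sub_edgeP[_ _]; rewrite edge_irrefl. Qed.

Definition graph_of_subgraph (G : sgraph) (H : subgraph G) : sgraph :=
  SGraph (@subgraph_edge_sym G H) (@subgraph_edge_irrefl G H).

Coercion graph_of_subgraph : subgraph >-> sgraph.

Definition covered_by (P : sgraph -> Prop) (G : sgraph) (c : nat) : Prop :=
  exists H : 'I_c -> subgraph G,
    (forall i, P (H i)) /\
    (forall x y : G, edge x y <-> exists i, sub_edge (H i) x y).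

Definition cover_number (P : sgraph -> Prop) (G : sgraph) : nat :=
  least_nat (covered_by P G).

(* The recursion starts at c = 1; the value at c = 0 is never used. *)
Fixpoint fk (k c : nat) : nat :=
  match c with
  | 0 => 0
  | 1 => k
  | c'.+1 => c * (k - 1) * fk k c'
  end.

Definition fk_inv (k n : nat) : nat :=
  least_nat (fun c => 0 < c /\ n <= fk k c).

(* The sets minimized by local_chromatic_number, cover_number (for the
   classes local_chromatic_le k with k >= 2) and fk_inv (for k >= 2) are nonempty, so the default value 0 of least_nat is never used for them. *)
Lemma local_chromatic_number_card (G : sgraph) :
  (exists phi : G -> nat,
     proper_coloring phi /\ local_colors phi = local_chromatic_number G) /\
  local_chromatic_number G <= #|G|.
Proof.
pose phi (x : G) : nat := enum_rank x.
have phiP : proper_coloring phi.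
  by move=> x y xy /ord_inj/enum_rank_inj exy; rewrite exy edge_irrefl in xy.
have [ex le] := @least_natP (fun m => exists phi : G -> nat,
  proper_coloring phi /\ local_colors phi = m) _ (ex_intro _ phi (conj phiP erefl)).
split=> //; apply: leq_trans le _; apply/bigmax_leqP => v _.
by rewrite (leq_trans (size_undup _))// size_map -cardE max_card.
Qed.

Lemma edge_subgraph_exists (G : sgraph) (x y : G) (k : nat) : 1 < k ->
  exists2 H : subgraph G, local_chromatic_le k H &
    forall a b, sub_edge H a b = edge a b && ([set a; b] == [set x; y]).
Proof.
move=> k_gt1.
have sym : symmetric (fun a b => edge a b && ([set a; b] == [set x; y])).
  by move=> a b; rewrite edge_sym setUC.
have sub a b : edge a b && ([set a; b] == [set x; y]) ->
    [/\ a \in [set x; y], b \in [set x; y] & edge a b].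
  by case/andP=> ab /eqP <-; rewrite !inE !eqxx orbT.
exists (Subgraph sym sub) => //.
apply: leq_trans (local_chromatic_number_card _).2 _.
rewrite /= card_sig; apply: leq_trans k_gt1.
by rewrite -[leqLHS]/#|[set x; y]| cards2; case: eqP.
Qed.

Lemma cover_number_attained (G : sgraph) (k : nat) : 1 < k ->
  covered_by (local_chromatic_le k) G (cover_number (local_chromatic_le k) G).
Proof.
move=> k_gt1.
have [F PF] : {F : G * G -> subgraph G & forall p,
    local_chromatic_le k (F p) /\
    forall a b, sub_edge (F p) a b = edge a b && ([set a; b] == [set p.1; p.2])}.
  apply: (@choice _ _ (fun p (H : subgraph G) => local_chromatic_le k H /\
    forall a b, sub_edge H a b = edge a b && ([set a; b] == [set p.1; p.2]))).
  by move=> p; have [H] := @edge_subgraph_exists G p.1 p.2 _ k_gt1; exists H.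
apply: (@least_natP (covered_by _ G) #|{: G * G}| _).1.
exists (fun i => F (enum_val i)); split=> [i | a b]; first by case: (PF (enum_val i)).
split=> [ab | [i]]; last by case: (PF (enum_val i)) => _ ->; case/andP.
exists (enum_rank (a, b)).
by rewrite enum_rankK; case: (PF (a, b)) => _ ->; rewrite ab eqxx.
Qed.

Lemma fk_inv_attained (k n : nat) : 2 <= k ->
  0 < fk_inv k n /\ n <= fk k (fk_inv k n).
Proof.
move=> k_ge2.
have fkS c : c < fk k c.+1.
  elim: c => [|c IHc]; first exact: leq_trans k_ge2.
  change (c.+1 < c.+2 * (k - 1) * fk k c.+1).
  apply: leq_trans (_ : c.+2 * 1 * 1 <= _); first by rewrite !muln1.
  by rewrite leq_mul ?leq_mul ?subn_gt0 // (leq_trans _ IHc).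
apply: (@least_natP (fun c => 0 < c /\ n <= fk k c) n.+1 _).1.
by split=> //; apply: ltnW.
Qed.

(* Main.v *)
Require Import Defs.
From mathcomp Require Import all_boot.
From mathcomp Require boolp.
From mathcomp Require Import zify.

Set Implicit Arguments.
Unset Strict Implicit.
Unset Printing Implicit Defensive.

(** Lower bound.  Let K be a clique of G whose edges are covered by c graphs
    E_i, each with a proper coloring f_i in which every vertex sees at most
    k - 1 colors besides its own.  A color class of f_i in K contains no edge
    of E_i, so it is a clique covered by the other c - 1 graphs; let m bound
    the sizes of these classes.  A vertex v of K then has at most (k - 1) m
    neighbors in each E_i, and its neighborhoods exhaust K minus v, whence
    #|K| <= c (k - 1) m + 1 (leq_card_clique_fibers).  For c = 1 we have m = 1
    and this is #|K| <= k.

    For m > 1 the extra 1 must be removed (leq_card_clique_fibers_strict).  If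
    #|K| = c (k - 1) m + 1, then every vertex has exactly (k - 1) m neighbors
    in every E_i.  As m does not divide #|K|, some class of f_i has fewer than
    m elements; let u belong to it and let v be a neighbor of u in E_i.  The
    neighborhood of v meets at most k - 1 classes, all of size at most m and
    that of u of size less than m, so v has fewer than (k - 1) m neighbors.
    Induction on c gives leq_card_clique_fk.

    Upper bound.  Fix a coloring f of G in which every vertex sees at most
    psi(G) - 1 other colors, and write k - 1 = a + b with a and b the two
    rounded halves of k - 1.  Every vertex splits the list of colors that it
    sees into consecutive groups of size a, and also into groups of size b.
    Orient each edge from u to v along an enumeration of the vertices, and put
    it into H_(i, j), where i is the a-group of u containing f v and j is the
    b-group of v containing f u.  In H_(i, j) a vertex sees at most a colors
    along outgoing edges and at most b along incoming ones, so with its own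
    color at most a + b + 1 = k (product_subgraph_local). *)

(** * Local colorings and color classes *)

Definition nbhd (T : finType) (E : rel T) (v : T) : {set T} := [set u | E v u].

(** At most k colors in each closed neighborhood: by properness the color of v
    itself is not among the colors of its neighbors, hence the strict bound on
    the open neighborhood. *)
Definition local_coloring (T C : finType) (k : nat) (E : rel T) (f : T -> C) :=
  (forall x y, E x y -> f x != f y) /\ (forall v, #|f @: nbhd E v| < k).

Section Fibers.
Variables (T C : finType) (f : T -> C).
Implicit Type A : {set T}.

Definition fiber A (y : C) : {set T} := [set x in A | f x == y].

Lemma card_fibers A : #|A| = \sum_(y in f @: A) #|fiber A y|.
Proof.
rewrite -sum1_card (partition_big f (mem (f @: A))) /=; last first.
  by move=> x xA; apply: imset_f.
by apply: eq_bigr => y _; rewrite -sum1_card; apply: eq_bigl => x; rewrite inE.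
Qed.

Lemma leq_card_fibers A m :
  (forall y, #|fiber A y| <= m) -> #|A| <= #|f @: A| * m.
Proof. by move=> le; rewrite card_fibers -sum_nat_const leq_sum. Qed.

Lemma ltn_card_fibers A m u : u \in A ->
  (forall y, #|fiber A y| <= m) -> #|fiber A (f u)| < m ->
  #|A| < #|f @: A| * m.
Proof.
move=> uA le lt; have fuA := imset_f f uA.
rewrite card_fibers -sum_nat_const (bigD1 (f u)) //= [ltnRHS](bigD1 (f u)) //=.
by rewrite -addSn leq_add // leq_sum.
Qed.

(** Otherwise all color classes would have size exactly m, and they partition
    A. *)
Lemma small_fiber_exists A m : ~~ (m %| #|A|) ->
  (forall y, #|fiber A y| <= m) -> exists2 u, u \in A & #|fiber A (f u)| < m.
Proof.
move=> ndvd le.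
case: (boolP [exists u in A, #|fiber A (f u)| < m]) => [/exists_inP // | noex].
case/negP: ndvd; rewrite card_fibers; apply: dvdn_sum => y /imsetP[u uA ->].
suff -> : #|fiber A (f u)| = m by [].
apply/eqP; rewrite eqn_leq le leqNgt; apply: contra noex => lt.
by apply/exists_inP; exists u.
Qed.

End Fibers.

(** * Cliques covered by locally colored graphs *)

Lemma leq_fk k c : 1 < k -> k <= fk k c.+1.
Proof.
move=> k_gt1; elim: c => // c IHc.
change (k <= c.+2 * (k - 1) * fk k c.+1); nia.
Qed.

Section CliqueCover.
Variables (T C J : finType) (k : nat) (E : J -> rel T) (f : J -> T -> C).
Hypothesis E_sym : forall i, symmetric (E i).
Hypothesis f_local : forall i, local_coloring k (E i) (f i).

Definition covers_clique (I : {set J}) (K : {set T}) :=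
  forall x y, x \in K -> y \in K -> x != y -> exists2 i, i \in I & E i x y.

(** The neighbors of v carry at most k - 1 colors. *)
Lemma leq_degree (K : {set T}) i m v :
  (forall y, #|fiber (f i) K y| <= m) ->
  #|K :&: nbhd (E i) v| <= (k - 1) * m.
Proof.
move=> le; apply: leq_trans (leq_card_fibers (f := f i) (m := m) _) _.
  move=> y; apply: leq_trans (le y); apply: subset_leq_card.
  by apply/subsetP=> x; rewrite !inE => /andP[/andP[-> _] ->].
rewrite leq_mul2r; apply/orP; right.
have := (f_local i).2 v.
have : #|f i @: (K :&: nbhd (E i) v)| <= #|f i @: nbhd (E i) v|.
  by apply/subset_leq_card/imsetS/subsetIr.
lia.
Qed.

Lemma leq_card_degrees I K v : covers_clique I K -> v \in K ->
  #|K| <= (\sum_(i in I) #|K :&: nbhd (E i) v|).+1.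
Proof.
move=> cov vK; rewrite (cardsD1 v) vK add1n ltnS.
apply: leq_trans (_ : #|\bigcup_(i in I) (K :&: nbhd (E i) v)| <= _).
  apply/subset_leq_card/subsetP => u /setD1P[uv uK].
  have [|i iI e] := cov v u vK uK; first by rewrite eq_sym.
  by apply/bigcupP; exists i; rewrite // !inE uK.
elim/big_rec2: _ => [|i n A _ le]; first by rewrite cards0.
by apply: leq_trans (leq_card_setU _ _) _; rewrite leq_add2l.
Qed.

Lemma leq_card_clique_fibers I K m : covers_clique I K ->
  (forall i y, i \in I -> #|fiber (f i) K y| <= m) ->
  #|K| <= (#|I| * ((k - 1) * m)).+1.
Proof.
move=> cov le; case: (set_0Vmem K) => [->|[v vK]]; first by rewrite cards0.
apply: leq_trans (leq_card_degrees cov vK) _.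
rewrite ltnS -sum_nat_const; apply: leq_sum => i iI.
by apply: leq_degree => y; apply: le.
Qed.

(** Equality in leq_card_clique_fibers forces all degrees to be maximal, hence
    all color classes to have size m, although m does not divide
    #|I| (k - 1) m + 1. *)
Lemma leq_card_clique_fibers_strict I K m : covers_clique I K ->
  I != set0 -> 1 < k -> 1 < m ->
  (forall i y, i \in I -> #|fiber (f i) K y| <= m) ->
  #|K| <= #|I| * ((k - 1) * m).
Proof.
move=> cov /set0Pn[i iI] k_gt1 m_gt1 le.
rewrite leqNgt; apply/negP => lt.
have cardK : #|K| = (#|I| * ((k - 1) * m)).+1.
  by apply/eqP; rewrite eqn_leq lt (leq_card_clique_fibers cov le).
have degE v : v \in K -> (k - 1) * m <= #|K :&: nbhd (E i) v|.
  move=> vK; have := leq_card_degrees cov vK.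
  rewrite cardK ltnS -sum_nat_const (bigD1 i) //= [leqRHS](bigD1 i) //=.
  have : \sum_(j in I | j != i) #|K :&: nbhd (E j) v|
      <= \sum_(j in I | j != i) (k - 1) * m.
    by apply: leq_sum => j /andP[jI _]; apply: leq_degree => y; apply: le.
  lia.
have ndvd : ~~ (m %| #|K|).
  by rewrite cardK -addn1 mulnA dvdn_addr ?dvdn_mull // dvdn1; lia.
have [u uK small] := small_fiber_exists ndvd (fun y => le i y iI).
(* u is not isolated in E i, and any neighbor v has too small a degree. *)
have : 0 < #|K :&: nbhd (E i) u| by apply: leq_trans (degE u uK); nia.
case/card_gt0P => v; rewrite !inE => /andP[vK uv].
have sub y : fiber (f i) (K :&: nbhd (E i) v) y \subset fiber (f i) K y.
  by apply/subsetP=> x; rewrite !inE => /andP[/andP[-> _] ->].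
have uN : u \in K :&: nbhd (E i) v by rewrite !inE uK E_sym.
have := @ltn_card_fibers _ _ (f i) (K :&: nbhd (E i) v) m u uN.
move=> /(_ (fun y => leq_trans (subset_leq_card (sub y)) (le i y iI))).
move=> /(_ (leq_ltn_trans (subset_leq_card (sub _)) small)).
have := degE v vK; have := (f_local i).2 v.
have : #|f i @: (K :&: nbhd (E i) v)| <= #|f i @: nbhd (E i) v|.
  by apply/subset_leq_card/imsetS/subsetIr.
nia.
Qed.

(** Two vertices of the same color are not adjacent in E i. *)
Lemma fiber_covers I K i y : covers_clique I K ->
  covers_clique (I :\ i) (fiber (f i) K y).
Proof.
move=> cov x z; rewrite !inE => /andP[xK /eqP fx] /andP[zK /eqP fz] xz.
have [j jI e] := cov x z xK zK xz; exists j => //; rewrite !inE jI andbT.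
by apply/eqP => ji; have := (f_local j).1 _ _ e; rewrite ji fx fz eqxx.
Qed.

(** The color classes of each f i satisfy the bound for #|I| - 1 graphs; when
    #|I| = 1 they are singletons. *)
Lemma leq_card_clique_fk I K : 1 < k -> I != set0 -> covers_clique I K ->
  #|K| <= fk k #|I|.
Proof.
move=> k_gt1; have [c] := ubnP #|I|; elim: c I K => // c IHc I K.
rewrite ltnS => ltIc I0 cov.
have I_gt0 : 0 < #|I| by rewrite card_gt0.
have cardD i : i \in I -> #|I| = #|I :\ i|.+1.
  by move=> iI; rewrite (cardsD1 i I) iI.
case: (ltngtP #|I| 1) => [|I_gt1|I1]; first by lia.
  have E1 : fk k #|I| = #|I| * ((k - 1) * fk k #|I|.-1).
    by case: #|I| I_gt1 => [|[|n]] // _; rewrite mulnA.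
  rewrite E1; apply: leq_card_clique_fibers_strict => //.
    by have := @leq_fk k #|I|.-2 k_gt1; rewrite prednK ?prednK //; lia.
  move=> i y iI; rewrite (cardD i iI) /=; apply: IHc; last exact: fiber_covers.
    by have := cardD i iI; lia.
  by rewrite -card_gt0; have := cardD i iI; lia.
rewrite I1 /=.
have := @leq_card_clique_fibers I K 1 cov; rewrite I1 mul1n muln1 => le.
suff : #|K| <= (k - 1).+1 by lia.
apply: le => i y iI; apply/card_le1_eqP => x z xF zF; apply/eqP.
apply: contraT => xz; have [j] := fiber_covers cov zF xF xz.
have /eqP := cardD i iI; rewrite I1 eq_sym eqSS cards_eq0 => /eqP->.
by rewrite inE.
Qed.

End CliqueCover.

(** * Local colorings and the local chromatic number *)

(** Replacing each numerical color by a vertex that has it gives a finite color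
    type that depends on G alone. *)
Lemma local_chromatic_le_coloring (G : sgraph) k : local_chromatic_le k G ->
  exists f : G -> G, local_coloring k (@edge G) f.
Proof.
have [[phi [phiP phiE]] _] := local_chromatic_number_card G.
rewrite /local_chromatic_le -phiE => /bigmax_leqP le.
pose f x := odflt x [pick y | phi y == phi x].
have fE x : phi (f x) = phi x.
  by rewrite /f; case: pickP => [y /eqP|].
have fP x y : phi x = phi y -> f x = f y.
  rewrite /f => exy; rewrite exy.
  by case: pickP => // /(_ y); rewrite eqxx.
exists f; split=> [x y xy | v].
  by apply/eqP => /(congr1 phi); rewrite !fE; apply: phiP.
apply: leq_trans (le v isT).
have -> : #|f @: nbhd (@edge G) v| .+1 =
    size (phi v :: map phi (enum (f @: nbhd (@edge G) v))).
  by rewrite /= size_map -cardE.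
apply: uniq_leq_size => [/=|c].
  apply/andP; split.
    apply/mapP => -[y]; rewrite mem_enum => /imsetP[u]; rewrite inE => vu ->.
    by rewrite fE; apply: phiP.
  rewrite map_inj_in_uniq ?enum_uniq // => x y; rewrite !mem_enum.
  by move=> /imsetP[u _ ->] /imsetP[w _ ->]; rewrite !fE => /fP.
rewrite mem_undup inE => /orP[/eqP->|/mapP[y]].
  by apply: image_f; rewrite inE eqxx.
rewrite mem_enum => /imsetP[u]; rewrite inE => vu -> ->.
by rewrite fE; apply: image_f; rewrite inE vu orbT.
Qed.

(** Vertices of G outside H all receive the color None, which is harmless since
    they are isolated for sub_edge H; the color type is the same for all H, so
    that a family of subgraphs can be colored at once. *)
Lemma subgraph_coloring (G : sgraph) (H : subgraph G) k : 0 < k ->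
  local_chromatic_le k H ->
  exists f : G -> option G, local_coloring k (sub_edge H) f.
Proof.
move=> k_gt0 /local_chromatic_le_coloring[f [fP fle]].
exists (fun x => omap (fun y => val (f y)) (insub x)); split=> [x y xy | v].
  have [xV yV _] := sub_edgeP xy.
  rewrite (insubT (mem (sub_vertices H)) xV) (insubT (mem (sub_vertices H)) yV) /=.
  by apply/eqP => -[] /val_inj/eqP; apply/negP; apply: fP.
case: (boolP (v \in sub_vertices H)) => vV; last first.
  have -> : nbhd (sub_edge H) v = set0.
    by apply/setP=> u; rewrite !inE; apply/negP => /sub_edgeP[]; rewrite (negPf vV).
  by rewrite imset0 cards0.
pose v' : H := Sub v vV.
apply: leq_ltn_trans (fle v').
have inj_some : injective (fun y : H => Some (val y)) by move=> y z [] /val_inj.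
rewrite -[leqRHS](card_imset _ inj_some); apply/subset_leq_card/subsetP => c.
case/imsetP => u; rewrite inE => vu ->; have [_ uV _] := sub_edgeP vu.
rewrite (insubT (mem (sub_vertices H)) uV) /=; apply: imset_f; apply: imset_f.
by rewrite inE.
Qed.

Lemma coloring_subgraph (G : sgraph) (H : subgraph G) (C : finType) k
  (f : G -> C) : local_coloring k (sub_edge H) f -> local_chromatic_le k H.
Proof.
move=> [fP fle].
pose phi (x : H) : nat := enum_rank (f (val x)).
have phiP : proper_coloring phi.
  move=> x y /fP /eqP xy /ord_inj /enum_rank_inj; exact: xy.
apply: leq_trans (least_natP (ex_intro _ phi (conj phiP erefl))).2 _.
apply/bigmax_leqP => v _.
apply: leq_trans (fle (val v)); rewrite cardE -(size_map (fun c => enum_rank c : nat)).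
rewrite -/(size (phi v :: map (fun c => enum_rank c : nat)
   (enum (f @: nbhd (sub_edge H) (val v))))).
apply: uniq_leq_size => [|c]; first exact: undup_uniq.
rewrite mem_undup => /imageP[u]; rewrite inE => /orP[/eqP->|vu] ->.
  by rewrite inE eqxx.
by rewrite inE; apply/orP; right; apply/map_f; rewrite mem_enum; apply: imset_f; rewrite inE.
Qed.

Lemma covered_by_clique_bound (G : sgraph) k c : 1 < k -> 0 < c ->
  covered_by (local_chromatic_le k) G c -> clique_number G <= fk k c.
Proof.
move=> k_gt1 c_gt0 [H [Hk HE]].
have [f f_local] := boolp.choice (fun i => subgraph_coloring (ltnW k_gt1) (Hk i)).
apply/bigmax_leqP => K /forall_inP cliqueK.
rewrite -[c]card_ord -cardsT.
apply: (leq_card_clique_fk (fun i => @sub_edge_sym _ (H i)) f_local k_gt1).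
  by rewrite -card_gt0 cardsT card_ord.
move=> x y xK yK xy; have /forall_inP/(_ y yK) := cliqueK x xK.
by rewrite xy => /HE[i e]; exists i.
Qed.

(** * Covering by products of color groups *)

(** S is cut into consecutive groups of size d along its enumeration. *)
Definition group (T : finType) (S : {set T}) (d : nat) (x : T) : nat :=
  index x (enum S) %/ d.

Lemma ltn_divn_ceil n d i : 0 < d -> i < n -> i %/ d < ceil_divn n d.
Proof.
move=> d_gt0 lt; rewrite ltn_divLR // /ceil_divn.
have := divn_eq (n + d.-1) d; have := ltn_pmod (n + d.-1) d_gt0; nia.
Qed.

Lemma group_lt (T : finType) (S : {set T}) d n x : 0 < d -> x \in S ->
  #|S| <= n -> group S d x < ceil_divn n d.
Proof.
move=> d_gt0 xS le; apply: ltn_divn_ceil => //.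
by apply: leq_trans le; rewrite cardE index_mem mem_enum.
Qed.

Lemma card_group (T : finType) (S : {set T}) d i : 0 < d ->
  #|[set x in S | group S d x == i]| <= d.
Proof.
move=> d_gt0; rewrite cardE -(size_map (fun x => index x (enum S))).
rewrite -[leqRHS](size_iota (i * d)); apply: uniq_leq_size => [|n].
  rewrite map_inj_in_uniq ?enum_uniq // => x y; rewrite !mem_enum !inE.
  move=> /andP[xS _] /andP[yS _]; apply: index_inj; rewrite ?mem_enum //.
case/mapP => x; rewrite mem_enum inE => /andP[_ /eqP <-] ->.
rewrite mem_iota /group.
have := divn_eq (index x (enum S)) d; have := ltn_pmod (index x (enum S)) d_gt0.
lia.
Qed.

Lemma covered_by_card (P : sgraph -> Prop) (G : sgraph) (I : finType)
    (H : I -> subgraph G) : (forall i, P (H i)) ->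
  (forall x y : G, edge x y -> exists i, sub_edge (H i) x y) ->
  covered_by P G #|I|.
Proof.
move=> HP HE; exists (fun j => H (enum_val j)); split=> // x y.
split=> [/HE[i e]|[j /sub_edgeP[]] //].
by exists (enum_rank i); rewrite enum_rankK.
Qed.

Section ProductCover.
Variables (G : sgraph) (C : finType) (p a b : nat) (f : G -> C).
Hypotheses (f_local : local_coloring p (@edge G) f) (a_gt0 : 0 < a) (b_gt0 : 0 < b).

Let seen (v : G) : {set C} := f @: nbhd (@edge G) v.

(** The arc from u to v lies in class (i, j) when f v is in the i-th group of
    size a of the colors seen by u, and f u in the j-th group of size b of the
    colors seen by v. *)
Definition arc_in (ij : 'I_(ceil_divn (p - 1) a) * 'I_(ceil_divn (p - 1) b)) : rel G :=
  fun u v => [&& edge u v, enum_rank u < enum_rank v,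
    group (seen u) a (f v) == ij.1 & group (seen v) b (f u) == ij.2].

Definition product_edge ij : rel G := fun u v => arc_in ij u v || arc_in ij v u.

Lemma product_edge_sym ij : symmetric (product_edge ij).
Proof. by move=> u v; apply: orbC. Qed.

Lemma product_edgeP ij u v : product_edge ij u v ->
  [/\ u \in [set: G], v \in [set: G] & edge u v].
Proof.
by rewrite !inE => /orP[] /and4P[e _ _ _]; split; rewrite // edge_sym.
Qed.

Definition product_subgraph ij : subgraph G :=
  Subgraph (@product_edge_sym ij) (@product_edgeP ij).

Lemma mem_seen u v : edge u v -> f v \in seen u.
Proof. by move=> e; apply: imset_f; rewrite inE. Qed.

(** The colors that v sees in class (i, j) lie in the i-th a-group of v for
    outgoing arcs and in the j-th b-group of v for incoming ones. *)
Lemma product_subgraph_local ij :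
  local_chromatic_le (a + b).+1 (product_subgraph ij).
Proof.
apply: (@coloring_subgraph _ _ _ _ f); split=> [x y /product_edgeP[_ _] | v].
  exact: f_local.1.
rewrite ltnS.
apply: leq_trans (leq_add (card_group (seen v) ij.1 a_gt0)
                          (card_group (seen v) ij.2 b_gt0)).
apply: leq_trans (leq_card_setU _ _); apply/subset_leq_card/subsetP => c.
case/imsetP => u; rewrite inE => /orP[] /and4P[e _ ga gb] ->; rewrite !inE.
  by rewrite mem_seen ?ga.
by rewrite mem_seen ?gb ?orbT // edge_sym.
Qed.

Lemma product_cover u v : edge u v -> exists ij, product_edge ij u v.
Proof.
have cov x y : edge x y -> enum_rank x < enum_rank y -> exists ij, arc_in ij x y.
  move=> e lt; have e' : edge y x by rewrite edge_sym.
  have le w : #|seen w| <= p - 1 by have := f_local.2 w; rewrite /seen; lia.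
  have ia := group_lt a_gt0 (mem_seen e) (le x).
  have jb := group_lt b_gt0 (mem_seen e') (le y).
  by exists (Ordinal ia, Ordinal jb); rewrite /arc_in e lt !eqxx.
move=> e; case: (ltngtP (enum_rank u) (enum_rank v)) => [lt|lt|].
- by have [ij h] := cov u v e lt; exists ij; rewrite /product_edge h.
- have [|ij h] := cov v u _ lt; first by rewrite edge_sym.
  by exists ij; rewrite /product_edge h orbT.
- by move=> /ord_inj/enum_rank_inj uv; rewrite uv edge_irrefl in e.
Qed.

End ProductCover.

Lemma leq_cover_number (G : sgraph) p a b : 0 < a -> 0 < b ->
  local_chromatic_le p G ->
  cover_number (local_chromatic_le (a + b).+1) G
    <= ceil_divn (p - 1) a * ceil_divn (p - 1) b.
Proof.
move=> a_gt0 b_gt0 /local_chromatic_le_coloring[f fP].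
have := covered_by_card (product_subgraph_local fP a_gt0 b_gt0)
  (product_cover fP a_gt0 b_gt0).
by rewrite card_prod !card_ord => /least_natP[].
Qed.

(** * The bounds *)

Lemma leq_fk_fact k x : 0 < x -> fk k x <= x`! * k ^ x.
Proof.
elim: x => // -[|x] IHx _; first by rewrite /= mul1n expn1.
change (x.+2 * (k - 1) * fk k x.+1 <= x.+2`! * k ^ x.+2).
apply: leq_trans (leq_mul (leq_mul (leqnn x.+2) (leq_subr 1 k)) (IHx isT)) _.
by rewrite (factS x.+1) (expnS k x.+1) mulnACA.
Qed.

Theorem theorem1p4 :
  (forall (G : sgraph) (k : nat), 3 <= k ->
     (has_edge G ->
        fk_inv k (clique_number G) <= cover_number (local_chromatic_le k) G) /\
     cover_number (local_chromatic_le k) G <=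
       ceil_divn (local_chromatic_number G - 1) ((k - 1)./2) *
       ceil_divn (local_chromatic_number G - 1) (uphalf (k - 1))) /\
  (exists C : nat, forall k x : nat, 3 <= k -> 0 < x ->
     fk k x <= C * (x`! * k ^ x)).
Proof.
split; last by exists 1 => k x _ x_gt0; rewrite mul1n leq_fk_fact.
move=> G k k_ge3; have k_gt1 : 1 < k by apply: ltnW.
split=> [[x [y xy]]|].
  have cov := cover_number_attained G k_gt1.
  have c_gt0 : 0 < cover_number (local_chromatic_le k) G.
    case: posnP cov => // -> [H [_ HE]]; by have [[]] := (HE x y).1 xy.
  have fk_ge := covered_by_clique_bound k_gt1 c_gt0 cov.
  by apply: (least_natP (P := fun c => 0 < c /\ _ <= fk k c) _).2.
have kE : k = ((k - 1)./2 + uphalf (k - 1)).+1 by lia.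
by rewrite {1}kE; apply: leq_cover_number; rewrite /local_chromatic_le //; lia.
Qed.
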